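(* $$\sum_{n\ge0}\Bigl(\sum_{\sigma\in\mathfrak S_n}u^{2{\rm L}(\sigma)}v^{n-2{\rm L}(\sigma)}\beta^{{\rm RLmin}(\sigma)}\Bigr)\frac{t^n}{n!}=\left(\frac{\sqrt{v^2-u^2}}{\sqrt{v^2-u^2}\cosh\bigl(t\sqrt{v^2-u^2}\bigr)-v\sinh\bigl(t\sqrt{v^2-u^2}\bigr)}\right)^{\beta}.$$
   Context: For $\sigma=\sigma_1\cdots\sigma_n\in\mathfrak S_n$ ($\mathfrak S_0$ = empty permutation): ${\rm L}(\sigma)$ is the number of $i$ with $1\le i<n$ and $\sigma_{i-1}<\sigma_i>\sigma_{i+1}$ (convention $\sigma_0=0$); ${\rm RLmin}(\sigma)$ is the number of $i$ with $\sigma_j>\sigma_i$ for all $j>i$. Identity of formal power series in $t$; the base is a power series in $t$ with constant term $1$ depending only on $v^2-u^2$ and $v$, and powers are defined by $G^c=\exp(c\log G)$. *)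

(* Defs.v *)
From mathcomp Require Import all_boot all_order all_algebra all_fingroup.
Set Implicit Arguments. Unset Strict Implicit. Unset Printing Implicit Defensive.
Import GRing.Theory.
Local Open Scope ring_scope.

Section FPS.
Variable R : fieldType.

Definition fps := nat -> R.

Definition ps_one : fps := fun n => (n == 0%N)%:R.
Definition ps_add (f g : fps) : fps := fun n => f n + g n.
Definition ps_scale (c : R) (f : fps) : fps := fun n => c * f n.
Definition ps_mul (f g : fps) : fps :=
  fun n => \sum_(i < n.+1) f i * g (n - i)%N.
Definition ps_pow (f : fps) (k : nat) : fps := iter k (ps_mul f) ps_one.

(* exp(h) = sum_k h^k / k!  (for h with constant term 0; the sum is finite
   in each coefficient since h^k has order >= k) *)
Definition ps_exp (h : fps) : fps :=
  fun n => \sum_(k < n.+1) ps_pow h k n / (k`!)%:R.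

(* log(G) = sum_{k>=1} (-1)^(k+1) (G-1)^k / k  (for G with constant term 1) *)
Definition ps_log (G : fps) : fps :=
  fun n => \sum_(1 <= k < n.+1)
             (-1) ^+ k.+1 / k%:R * ps_pow (ps_add G (ps_scale (-1) ps_one)) k n.

(* 1/g = g0^-1 * sum_k (1 - g/g0)^k  (for g with invertible constant term g0) *)
Definition ps_inv (g : fps) : fps :=
  fun n => (g 0%N)^-1 *
    \sum_(k < n.+1) ps_pow (ps_add ps_one (ps_scale (- (g 0%N)^-1) g)) k n.

Definition ps_powc (G : fps) (c : R) : fps := ps_exp (ps_scale c (ps_log G)).

Definition ps_cosh (s : R) : fps :=
  fun n => if odd n then 0 else s ^+ n / (n`!)%:R.
Definition ps_sinh (s : R) : fps :=
  fun n => if odd n then s ^+ n / (n`!)%:R else 0.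

(* the base  s / (s cosh(t s) - v sinh(t s)),  s = sqrt(v^2-u^2) *)
Definition base_series (s v : R) : fps :=
  ps_scale s (ps_inv (ps_add (ps_scale s (ps_cosh s)) (ps_scale (- v) (ps_sinh s)))).

End FPS.

Definition perm_word n (s : 'S_n) : seq nat := [seq (s i).+1 | i <- enum 'I_n].

(* L(sigma): number of i, 1 <= i < n, with sigma_{i-1} < sigma_i > sigma_{i+1},
   sigma_0 = 0.  With w = 0 :: word, this is w_j < w_{j+1} > w_{j+2}, 0 <= j < n-1. *)
Definition peakL n (s : 'S_n) : nat :=
  let w := 0%N :: perm_word s in
  count (fun j => (nth 0%N w j < nth 0%N w j.+1)%N && (nth 0%N w j.+2 < nth 0%N w j.+1)%N)
        (iota 0 n.-1).

Definition RLmin n (s : 'S_n) : nat :=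
  let w := perm_word s in
  count (fun i => all (fun j => (nth 0%N w i < nth 0%N w j)%N) (iota i.+1 (n - i.+1)))
        (iota 0 n).

(* Main.v *)
Require Import Defs.
From mathcomp Require Import all_boot all_order all_algebra all_fingroup.
From mathcomp Require Import ring zify.
Import GRing.Theory.
Local Open Scope ring_scope.

(* Put c = s^2 = v^2 - u^2, keep c fixed and regard the n-th sum as a polynomial
   Q_n in v, with u^2 = v^2 - c.  Inserting the largest letter at the end of a
   word multiplies the weight by beta v; inserting it next to one of the L peaks
   preserves L, and inserting it at one of the n - 2L remaining places creates a
   peak.  Hence Q_{n+1} = beta v Q_n + D Q_n for the derivation
   D = (v^2 - c) d/dv.  With A_n = D^n v, the Leibniz rule turns this into
   Q_{n+1} = beta sum_k C(n,k) A_k Q_{n-k} and, D killing constants,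
   A_{n+1} = sum_k C(n,k) A_k A_{n-k} - c [n = 0].  The exponential generating
   functions f of Q and a of A therefore satisfy f' = beta a f and a' = a^2 - c.
   If y = s cosh(st) - v sinh(st), then y'' = c y, so that z = y a + y' solves
   z' = a z with z(0) = 0 and vanishes: a = -y'/y is the logarithmic derivative
   of the base s/y, and its beta-th power satisfies the equation of f. *)

(** * Peaks and right-to-left minima of words *)

Fixpoint peaks (a : nat) (w : seq nat) : nat :=
  if w is b :: r then
    if r is c :: _ then ((a < b) && (c < b) + peaks b r)%N else 0%N
  else 0%N.

Fixpoint rlmins (w : seq nat) : nat :=
  if w is b :: r then (all (ltn b) r + rlmins r)%N else 0%N.

Definition insert_at (x i : nat) (w : seq nat) : seq nat :=
  take i w ++ x :: drop i w.

Lemma count_peaks (a : nat) (w : seq nat) :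
  count (fun j => (nth 0 (a :: w) j < nth 0 (a :: w) j.+1)
                  && (nth 0 (a :: w) j.+2 < nth 0 (a :: w) j.+1))%N
        (iota 0 (size w).-1)
  = peaks a w.
Proof.
elim: w a => [|b [|c r] IH] a //=.
have /= <- := IH b.
by rewrite -[1%N]/(1 + 0)%N iotaDl count_map.
Qed.

Lemma count_rlmins (w : seq nat) :
  count (fun i => all (fun j => nth 0 w i < nth 0 w j)%N
                      (iota i.+1 (size w - i.+1)))
        (iota 0 (size w))
  = rlmins w.
Proof.
elim: w => [|b r IH] //.
rewrite [size _]/= [iota _ _]/= [count _ _]/= [rlmins _]/=; congr addn.
  rewrite subSS subn0 -[1%N]/(1 + 0)%N iotaDl all_map; congr nat_of_bool.
  by rewrite -[in RHS](mkseq_nth 0%N r) /mkseq all_map.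
rewrite -IH -[1%N]/(1 + 0)%N iotaDl count_map; apply: eq_count => i /=.
rewrite subSS -[i.+2]/(1 + i.+1)%N iotaDl all_map.
by apply: eq_all => j.
Qed.

(** The letter after a peak is smaller, hence no peak, so two letters can be charged to each peak.
    The induction runs on a bound for the length because a peak removes two letters at once. *)
Lemma leq_peaks (a : nat) (w : seq nat) : (2 * peaks a w <= size w)%N.
Proof.
elim: {w}(size w) {-2}w (leqnn (size w)) a => [|m IH] [|b [|c r]] //= le_m a.
have [/andP[_ lt_cb]|_] := boolP ((a < b) && (c < b))%N; last first.
  by have := IH (c :: r) le_m b; rewrite /= in le_m *; lia.
case: r le_m => [|d r] le_m; first by rewrite /=; lia.
have := IH (d :: r) (ltnW le_m) c.
by rewrite /= [(b < c)%N]ltnNge (ltnW lt_cb) /=; lia.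
Qed.

(** The preceding letter matters only through its comparison with [c], which is no ascent in either
    case. *)
Lemma peaks_descent (a b c : nat) (r : seq nat) :
  (c <= a)%N -> (c <= b)%N -> peaks a (c :: r) = peaks b (c :: r).
Proof. by case: r => [|d r] //= leca lecb; rewrite ![(_ < c)%N]ltnNge leca lecb. Qed.

(* Inserting [M] next to a peak moves this peak to [M]; elsewhere it creates a
   new one.  Each peak has two adjacent gaps, and no gap is adjacent to two
   peaks.  The gap after the last letter is left out. *)
Lemma peaks_insert_sum {V : comPzRingType} (phi : nat -> V) (M a : nat)
    (w : seq nat) :
  (a < M)%N -> all (fun x => x < M)%N w ->
  \sum_(i < size w) phi (peaks a (insert_at M i w))
  = (size w)%:R * phi (peaks a w).+1
    + (2 * peaks a w)%:R * (phi (peaks a w) - phi (peaks a w).+1).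
Proof.
elim: w phi a => [|b [|c r] IH] phi a ltaM.
- by rewrite big_ord0 /= !mul0r addr0.
- by rewrite /= big_ord1 /insert_at /= !mul0r addr0 mul1r andbT => ->; rewrite ltaM.
case/andP=> ltbM allr; have ltcM : (c < M)%N by case/andP: allr.
have nMb : (M < b)%N = false by rewrite ltnNge (ltnW ltbM).
have first_gap : peaks a (insert_at M 0 [:: b, c & r]) = (peaks b (c :: r)).+1.
  by rewrite /insert_at /= ltaM ltbM nMb.
have second_gap : peaks a (insert_at M 1 [:: b, c & r]) = (peaks M (c :: r)).+1.
  by rewrite /insert_at /= [(M < b)%N]nMb ltbM ltcM andbF.
have second_gap' : peaks b (insert_at M 0 (c :: r)) = (peaks M (c :: r)).+1.
  by rewrite /insert_at /= ltbM ltcM.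
have later_gap i : peaks a (insert_at M i.+2 [:: b, c & r])
    = (((a < b) && (c < b)) + peaks b (insert_at M i.+1 (c :: r)))%N by [].
rewrite [peaks a _]/= -/(peaks b (c :: r)) [size [:: b, c & r]]/=.
rewrite 2!big_ord_recl first_gap second_gap.
under eq_bigr => i _ do rewrite later_gap.
(* If [b] is a peak, both first gaps are adjacent to it and keep the count, while each later count
   is one more than in the tail: the induction hypothesis serves for the shifted [phi], with its
   first gap removed. *)
have [/andP[ltab ltcb]|_] := boolP ((a < b) && (c < b))%N.
  have := IH (fun k => phi k.+1) b ltbM allr.
  rewrite big_ord_recl second_gap' (@peaks_descent M b) ?(ltnW ltcM) ?(ltnW ltcb) //.
  move=> /(canRL (addKr _)) ->; rewrite /= !add1n.
  ring.
(* Otherwise the second gap counts like the first gap of the tail, and only the first gap, which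
   creates a peak, is new. *)
have := IH phi b ltbM allr; rewrite big_ord_recl second_gap' => -> /=.
ring.
Qed.

(** The new letter has a smaller one to its right, and being an upper bound it spoils no other
    minimum. *)
Lemma rlmins_insert (M i : nat) (w : seq nat) :
  all (fun x => x < M)%N w -> (i < size w)%N ->
  rlmins (insert_at M i w) = rlmins w.
Proof.
elim: w i => [|b r IH] [|i] //= /andP[ltbM allr].
  by rewrite /insert_at /= [(M < b)%N]ltnNge (ltnW ltbM).
move=> lti; rewrite -[in RHS](IH i) //; congr addn; congr nat_of_bool.
by rewrite -[r in RHS](cat_take_drop i) !all_cat /= ltbM.
Qed.

Lemma rlmins_rcons (M : nat) (w : seq nat) :
  all (fun x => x < M)%N w -> rlmins (rcons w M) = (rlmins w).+1.
Proof.
by elim: w => [|b r IH] //= /andP[ltbM /IH ->]; rewrite all_rcons /= ltbM addnS.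
Qed.

(** A last letter never counts as a peak, and the former last letter is no peak before a larger
    one. *)
Lemma peaks_rcons (M a : nat) (w : seq nat) :
  all (fun x => x < M)%N w -> peaks a (rcons w M) = peaks a w.
Proof.
elim: w a => [|b [|c r] IH] a //= /andP[ltbM allr].
  by rewrite [(M < b)%N]ltnNge (ltnW ltbM) andbF.
by have /= -> := IH b allr.
Qed.

(** * Words of permutations and insertion of the largest letter *)

Lemma size_perm_word {n} (s : 'S_n) : size (perm_word s) = n.
Proof. by rewrite size_map size_enum_ord. Qed.

Lemma nth_perm_word {n} (s : 'S_n) (i : 'I_n) : nth 0%N (perm_word s) i = (s i).+1.
Proof. by rewrite (nth_map i) ?size_enum_ord // nth_ord_enum. Qed.

Lemma peakLE {n} (s : 'S_n) : peakL s = peaks 0 (perm_word s).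
Proof. by rewrite -count_peaks size_perm_word. Qed.

Lemma RLminE {n} (s : 'S_n) : RLmin s = rlmins (perm_word s).
Proof. by rewrite -count_rlmins size_perm_word. Qed.

Lemma perm_word_ltn {n} (s : 'S_n) : all (fun x => x < n.+1)%N (perm_word s).
Proof. by rewrite /perm_word all_map; apply/allP => i _ /=; rewrite ltnS. Qed.

Lemma perm_word_lift {n} (i : 'I_n.+1) (s : 'S_n) :
  perm_word (lift_perm i ord_max s) = insert_at n.+1 i (perm_word s).
Proof.
have szt : size (take i (perm_word s)) = i.
  by rewrite size_takel // size_perm_word -ltnS.
apply: (@eq_from_nth _ 0%N) => [|k].
  rewrite size_perm_word size_cat szt /= size_drop size_perm_word.
  by rewrite addnS subnKC // -ltnS.
rewrite size_perm_word => ltk; rewrite -[k]/(val (Ordinal ltk)).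
rewrite nth_perm_word nth_cat szt.
have [j ->|->] := unliftP i (Ordinal ltk); last first.
  by rewrite lift_perm_id ltnn subnn.
rewrite lift_perm_lift [nat_of_ord (lift ord_max _)]lift_max.
rewrite -(nth_perm_word s j) /= /bump.
have [leij|ltji] := leqP i j.
  rewrite add1n ltnNge (leqW leij) /= subSn //= nth_drop subnKC //.
by rewrite add0n ltji nth_take.
Qed.

(** The position of the largest letter and the remaining permutation can be read off, so insertion
    is injective; it is bijective because (n+1)! = (n+1) n!. *)
Lemma sum_perm_lift {V : zmodType} {n} (F : 'S_n.+1 -> V) :
  \sum_(s : 'S_n.+1) F s
  = \sum_(s : 'S_n) \sum_(i < n.+1) F (lift_perm i ord_max s).
Proof.
rewrite pair_bigA /=.
apply: (reindex (fun p : 'S_n * 'I_n.+1 => lift_perm p.2 ord_max p.1)).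
apply/onW_bij/inj_card_bij => [[s i] [t j] /= eqst|]; last first.
  by rewrite card_prod !card_Sn card_ord factS mulnC.
have eqij : i = j.
  by apply: (@perm_inj _ (lift_perm i ord_max s)); rewrite {2}eqst !lift_perm_id.
congr pair => //; apply/permP => k; apply: (@lift_inj _ ord_max).
by rewrite -(lift_perm_lift i) eqst -eqij lift_perm_lift.
Qed.

(** * The derivation D and the binomial recurrences *)

Definition flow {R : comNzRingType} (c : R) (p : {poly R}) : {poly R} :=
  ('X^2 - c%:P) * p^`().

(** This is Q_n, with ['X] for v and ['X^2 - c%:P] for u^2; [flow_iter] is A_n. *)
Definition peak_poly {R : comNzRingType} (c beta : R) (n : nat) : {poly R} :=
  \sum_(sigma : 'S_n)
    ('X^2 - c%:P) ^+ peakL sigma * 'X^(n - 2 * peakL sigma)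
    * (beta ^+ RLmin sigma)%:P.

Definition flow_iter {R : comNzRingType} (c : R) (n : nat) : {poly R} :=
  iter n (flow c) 'X.

Lemma flowM {R : comNzRingType} (c : R) (p q : {poly R}) :
  flow c (p * q) = flow c p * q + p * flow c q.
Proof. by rewrite /flow derivM; ring. Qed.

Lemma flowC {R : comNzRingType} (c b : R) : flow c b%:P = 0.
Proof. by rewrite /flow derivC mulr0. Qed.

Lemma flow_sum {R : comNzRingType} (c : R) (I : finType) (F : I -> {poly R}) :
  flow c (\sum_i F i) = \sum_i flow c (F i).
Proof. by rewrite /flow raddf_sum mulr_sumr. Qed.

(** For q = v^2 - c one has D v = q and D q = 2 v q: the factors q account for the gaps next to
    peaks, the factors v for the others. The right-hand side is arranged to match
    [peaks_insert_sum]. *)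
Lemma flow_monomial {R : comNzRingType} (c : R) (n l : nat) : (2 * l <= n)%N ->
  flow c (('X^2 - c%:P) ^+ l * 'X^(n - 2 * l))
  = n%:R * (('X^2 - c%:P) ^+ l.+1 * 'X^(n.+1 - 2 * l.+1))
    + (2 * l)%:R * (('X^2 - c%:P) ^+ l * 'X^(n.+1 - 2 * l)
                     - ('X^2 - c%:P) ^+ l.+1 * 'X^(n.+1 - 2 * l.+1)).
Proof.
move=> le_ln; have [m ->] : exists m, n = (2 * l + m)%N.
  by exists (n - 2 * l)%N; rewrite subnKC.
rewrite /flow derivM derivXn deriv_exp derivB derivXn derivC subr0.
have -> : (2 * l + m - 2 * l = m)%N by lia.
have -> : ((2 * l + m).+1 - 2 * l = m.+1)%N by lia.
(* At m = 0 this subtraction is truncated, harmlessly, as the total coefficient of the term is m. *)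
have -> : ((2 * l + m).+1 - 2 * l.+1 = m.-1)%N by lia.
move: ('X^2 - c%:P) => q; rewrite /= expr1.
rewrite -[_ *+ l]mulr_natl -[_ *+ m]mulr_natl -[_ *+ 2]mulr_natl.
rewrite natrD natrM; move: 'X => x; rewrite mulrDr.
have ql : l%:R * (q * q ^+ l.-1) = l%:R * q ^+ l.
  by case: (l) => [|k]; rewrite ?mul0r // exprS.
rewrite (exprS q) (exprS x).
transitivity (2 * (l%:R * (q * q ^+ l.-1)) * x * x ^+ m
  + m%:R * q * q ^+ l * x ^+ m.-1); first by ring.
rewrite ql.
ring.
Qed.

Lemma peak_polyS {R : comNzRingType} (c beta : R) (n : nat) :
  peak_poly c beta n.+1
  = beta%:P * 'X * peak_poly c beta n + flow c (peak_poly c beta n).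
Proof.
rewrite /peak_poly sum_perm_lift flow_sum mulr_sumr -big_split /=.
apply: eq_bigr => s _.
have Ws := perm_word_ltn s.
have le_peaks : (2 * peakL s <= n)%N.
  by rewrite peakLE -[n in (_ <= n)%N](size_perm_word s) leq_peaks.
rewrite flowM flowC mulr0 addr0.
rewrite flow_monomial //.
(* The last gap yields the factor beta v; the others are handled by [peaks_insert_sum]. *)
rewrite big_ord_recr /= addrC; congr (_ + _).
  rewrite peakLE RLminE perm_word_lift /insert_at /=.
  rewrite -[n in take n](size_perm_word s) -[n in drop n](size_perm_word s).
  rewrite take_size drop_size cats1 peaks_rcons // rlmins_rcons //.
  rewrite -peakLE -RLminE subSn //.
  by rewrite !exprS polyCM; ring.
pose phi k : {poly R} := ('X^2 - c%:P) ^+ k * 'X^(n.+1 - 2 * k).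
have := peaks_insert_sum phi _ _ _ (ltn0Sn n) Ws.
rewrite size_perm_word -peakLE => <-.
rewrite mulr_suml; apply: eq_bigr => i _.
rewrite peakLE RLminE perm_word_lift /= rlmins_insert ?size_perm_word //.
by rewrite -RLminE.
Qed.

(** Pascal's rule in the form of a Leibniz rule: raising an index plays the role of differentiating
    that factor. *)
Lemma sum_binS {R : comNzRingType} (p q : nat -> R) (n : nat) :
  \sum_(k < n.+2) 'C(n.+1, k)%:R * p k * q (n.+1 - k)%N
  = \sum_(k < n.+1) 'C(n, k)%:R * (p k.+1 * q (n - k)%N + p k * q (n - k).+1).
Proof.
rewrite big_ord_recl /= bin0 subn0 mul1r.
under eq_bigr => k _ do
  rewrite /bump /= add1n binS natrD subSS !mulrDl.
rewrite big_split /= addrA.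
under [in RHS]eq_bigr => k _ do rewrite mulrDr !mulrA.
rewrite [RHS]big_split /= addrC; congr (_ + _).
rewrite big_ord_recr /= bin_small // !mul0r addr0.
rewrite [RHS]big_ord_recl /= bin0 subn0 mul1r; congr (_ + _).
apply: eq_bigr => k _; rewrite /bump /= add1n -subSn ?subSS //.
Qed.

Lemma flow_sum_bin {R : comNzRingType} (c : R) (p q : nat -> {poly R}) (n : nat) :
  flow c (\sum_(k < n.+1) 'C(n, k)%:R * p k * q (n - k)%N)
  = \sum_(k < n.+1) 'C(n, k)%:R
      * (flow c (p k) * q (n - k)%N + p k * flow c (q (n - k)%N)).
Proof.
rewrite flow_sum; apply: eq_bigr => k _.
by rewrite !flowM -polyC_natr flowC; ring.
Qed.

Lemma peak_poly0 {R : comNzRingType} (c beta : R) : peak_poly c beta 0 = 1.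
Proof.
rewrite /peak_poly (big_pred1 1%g) => [|s]; last by apply/esym/eqP/permP => -[].
by rewrite peakLE RLminE (size0nil (size_perm_word _)) /= !expr0 !mul1r.
Qed.

(** On a product A Q, the operator beta v + D acts as D on A plus itself on Q. Applied to the
    convolution, it thus raises one index at a time, as in [sum_binS]. *)
Lemma peak_poly_rec {R : comNzRingType} (c beta : R) (n : nat) :
  peak_poly c beta n.+1
  = beta%:P * \sum_(k < n.+1)
      'C(n, k)%:R * flow_iter c k * peak_poly c beta (n - k).
Proof.
elim: n => [|n IH].
  rewrite peak_polyS big_ord1 /= subn0 bin0 peak_poly0 -polyC1 flowC polyC1; ring.
rewrite peak_polyS IH flowM flowC mul0r add0r flow_sum_bin sum_binS.
rewrite mulrCA -mulrDr mulr_sumr -big_split; congr (_ * _).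
apply: eq_bigr => k _; rewrite peak_polyS /=; ring.
Qed.

Lemma flow_iter_rec {R : comNzRingType} (c : R) (n : nat) :
  flow_iter c n.+1
  = \sum_(k < n.+1) 'C(n, k)%:R * flow_iter c k * flow_iter c (n - k)
    - (if n == 0%N then c else 0)%:P.
Proof.
elim: n => [|n IH].
  by rewrite big_ord1 /= /flow derivX bin0; ring.
rewrite {1}/flow_iter iterS -/(flow_iter c n.+1) IH {1}/flow derivB derivC subr0.
by rewrite -/(flow _ _) flow_sum_bin sum_binS subr0.
Qed.

(** * Truncated power series: inverse, logarithm and exponential *)

(* Power series are handled through polynomials agreeing with them up to a
   given order, so that identities hold modulo a power of ['X]. *)
Definition truncates {R : fieldType} (N : nat) (p : {poly R}) (f : fps R) : Prop :=
  forall i, (i < N)%N -> p`_i = f i.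

Lemma dvdXnP {R : fieldType} (N : nat) (p : {poly R}) :
  reflect (forall i, (i < N)%N -> p`_i = 0) ('X^N %| p)%R.
Proof.
apply: (iffP idP) => [/dvdpP[q ->] i ltiN|p0]; first by rewrite coefMXn ltiN.
apply/dvdpP; exists (drop_poly N p); rewrite -{1}[p](poly_take_drop N).
suff -> : take_poly N p = 0 by rewrite add0r.
by apply/polyP => i; rewrite coef_take_poly coef0; case: ifP => // /p0.
Qed.

Lemma dvdXn_deriv {R : fieldType} (N : nat) (p : {poly R}) :
  'X^(N.+1) %| p -> 'X^N %| p^`().
Proof.
move=> /dvdXnP p0; apply/dvdXnP => i ltiN.
by rewrite coef_deriv p0 ?mul0rn.
Qed.

Lemma dvdXn_exp {R : fieldType} (N k : nat) (p : {poly R}) :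
  p`_0 = 0 -> (N <= k)%N -> 'X^N %| p ^+ k.
Proof.
move=> p0 leNk; apply: dvdp_trans (dvdp_exp2l 'X leNk) _.
by apply: dvdp_exp2r; rewrite -[X in X %| _]expr1; apply/dvdXnP => -[].
Qed.

Lemma natr_neq0 {R : fieldType} (charR0 : [pchar R] =i pred0) (n : nat) :
  (n.+1%:R : R) != 0.
Proof. by rewrite ((pcharf0P R).1 charR0). Qed.

Lemma fact_neq0 {R : fieldType} (charR0 : [pchar R] =i pred0) (n : nat) :
  (n`!%:R : R) != 0.
Proof. by rewrite ((pcharf0P R).1 charR0) -lt0n fact_gt0. Qed.

(** Coefficient i of z' = a z expresses (i+1) z_{i+1} through z_0, ..., z_i, and i+1 is invertible.
    Integration gains one order. *)
Lemma linear_ode0 {R : fieldType} (charR0 : [pchar R] =i pred0) (N : nat)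
    (a z : {poly R}) :
  z`_0 = 0 -> 'X^N %| z^`() - a * z -> 'X^(N.+1) %| z.
Proof.
move=> z0 /dvdXnP ode; apply/dvdXnP => i.
elim/ltn_ind: i => -[|i] // IH ltiN.
have := ode i ltiN; rewrite coefB coef_deriv coefM big1 => [|j _]; last first.
  by rewrite IH ?mulr0 //; have := ltn_ord j; lia.
rewrite subr0 -mulr_natr => /eqP.
by rewrite mulf_eq0 (negPf (natr_neq0 charR0 i)) orbF => /eqP.
Qed.

Lemma truncates_poly {R : fieldType} (N : nat) (f : fps R) :
  truncates N (\poly_(i < N) f i) f.
Proof. by move=> i ltiN; rewrite coef_poly ltiN. Qed.

Lemma truncates_one {R : fieldType} (N : nat) : truncates N 1 (ps_one R).
Proof. by move=> i _; rewrite coef1. Qed.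

Lemma truncates_add {R : fieldType} (N : nat) (p q : {poly R}) (f g : fps R) :
  truncates N p f -> truncates N q g -> truncates N (p + q) (ps_add f g).
Proof. by move=> pf qg i ltiN; rewrite coefD pf ?qg. Qed.

Lemma truncates_scale {R : fieldType} (N : nat) (c : R) (p : {poly R})
    (f : fps R) :
  truncates N p f -> truncates N (c *: p) (ps_scale c f).
Proof. by move=> pf i ltiN; rewrite coefZ pf. Qed.

Lemma truncates_pow {R : fieldType} (N : nat) (p : {poly R}) (f : fps R)
    (k : nat) :
  truncates N p f -> truncates N (p ^+ k) (ps_pow f k).
Proof.
move=> pf; elim: k => [|k IH]; first exact: truncates_one.
move=> i ltiN; rewrite exprS coefM; apply: eq_bigr => j _.
by have := ltn_ord j => ltj; rewrite pf ?IH //; lia.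
Qed.

Lemma coef_exp_small {R : fieldType} (p : {poly R}) (i k : nat) :
  p`_0 = 0 -> (i < k)%N -> (p ^+ k)`_i = 0.
Proof. by move=> p0 ltik; apply: (dvdXnP _ _ (@dvdXn_exp R k k p p0 (leqnn k))). Qed.

(* The powers of a series without constant term that the definitions of [Defs]
   leave out contribute nothing. *)
Lemma coef_sum_exp {R : fieldType} (N : nat) (c : nat -> R) (p : {poly R})
    (h : fps R) (i : nat) : truncates N.+1 p h -> p`_0 = 0 ->
  (i < N.+1)%N ->
  (\sum_(k < N.+1) c k *: p ^+ k)`_i = \sum_(k < i.+1) c k * ps_pow h k i.
Proof.
move=> ph p0 ltiN; rewrite coef_sum.
rewrite [RHS](big_ord_widen N.+1 (fun k => c k * ps_pow h k i) ltiN) [RHS]big_mkcond.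
apply: eq_bigr => k _; rewrite coefZ ltnS.
have [_|ltik] := leqP k i; last by rewrite coef_exp_small ?mulr0.
by congr (_ * _); exact: (truncates_pow _ _ _ k ph).
Qed.

Lemma truncates_exp {R : fieldType} (N : nat) (p : {poly R}) (h : fps R) :
  truncates N.+1 p h -> p`_0 = 0 ->
  truncates N.+1 (\sum_(k < N.+1) (k`!)%:R^-1 *: p ^+ k) (ps_exp h).
Proof.
move=> ph p0 i ltiN.
rewrite (@coef_sum_exp _ _ (fun k => (k`!)%:R^-1) p h) //.
by apply: eq_bigr => k _; rewrite mulrC.
Qed.

(* The term [k = 0] of this sum vanishes because [0^-1 = 0]. *)
Lemma truncates_log {R : fieldType} (N : nat) (p : {poly R}) (g : fps R) :
  truncates N.+1 p g -> p`_0 = 1 ->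
  truncates N.+1 (\sum_(k < N.+1) ((-1) ^+ k.+1 / k%:R) *: (p - 1) ^+ k) (ps_log g).
Proof.
move=> pg p0 i ltiN.
rewrite (@coef_sum_exp _ _ (fun k => (-1) ^+ k.+1 / k%:R) (p - 1)
           (ps_add g (ps_scale (-1) (ps_one R)))) //.
- rewrite -(big_mkord predT (fun k => (-1) ^+ k.+1 / k%:R * ps_pow _ k i)).
  by rewrite big_ltn // invr0 mulr0 mul0r add0r.
- rewrite -scaleN1r; apply: truncates_add => //.
  by apply: truncates_scale; apply: truncates_one.
- by rewrite coefB coef1 p0 subrr.
Qed.

Lemma truncates_inv {R : fieldType} (N : nat) (p : {poly R}) (g : fps R) :
  truncates N.+1 p g -> p`_0 != 0 ->
  truncates N.+1 ((p`_0)^-1 *: \sum_(k < N.+1) (1 - (p`_0)^-1 *: p) ^+ k) (ps_inv g).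
Proof.
move=> pg p0 i ltiN; rewrite coefZ /ps_inv -(pg 0%N) //; congr (_ * _).
under eq_bigr => k _ do rewrite -[_ ^+ k]scale1r.
rewrite (@coef_sum_exp _ _ (fun=> 1) _
           (ps_add (ps_one R) (ps_scale (- (g 0%N)^-1) g))) //.
- by rewrite (pg 0%N) //; apply: eq_bigr => k _; rewrite mul1r.
- rewrite -scaleNr -(pg 0%N) //; apply: truncates_add; first exact: truncates_one.
  exact: truncates_scale.
- by rewrite coefB coef1 coefZ mulVf // subrr.
Qed.

(** With q = 1 - p/p_0 the geometric sum telescopes to 1 - q^N, and q has no constant term. *)
Lemma inv_congr {R : fieldType} (N : nat) (p : {poly R}) : p`_0 != 0 ->
  'X^N %| p * ((p`_0)^-1 *: \sum_(k < N) (1 - (p`_0)^-1 *: p) ^+ k) - 1.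
Proof.
move=> p0; set q := 1 - _.
have q0 : q`_0 = 0 by rewrite coefB coef1 coefZ mulVf // subrr.
have -> : p * ((p`_0)^-1 *: \sum_(k < N) q ^+ k) = 1 - q ^+ N.
  rewrite -scalerAr scalerAl -[(p`_0)^-1 *: p](subKr 1) -/q.
  by apply: oppr_inj; rewrite -mulNr !opprB subrX1.
by rewrite addrAC subrr add0r dvdpNr dvdXn_exp.
Qed.

(** Differentiating termwise gives p' times the geometric sum in 1 - p, which inverts p up to order
    N. *)
Lemma log_congr {R : fieldType} (charR0 : [pchar R] =i pred0) (N : nat)
    (p : {poly R}) : p`_0 = 1 ->
  'X^N %| p * (\sum_(k < N.+1) ((-1) ^+ k.+1 / k%:R) *: (p - 1) ^+ k)^`() - p^`().
Proof.
move=> p0; rewrite raddf_sum big_ord_recl /= invr0 mulr0 scale0r deriv0 add0r.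
have -> : \sum_(k < N) (((-1) ^+ (bump 0 k).+1 / (bump 0 k)%:R)
             *: (p - 1) ^+ bump 0 k)^`() = p^`() * \sum_(k < N) (1 - p) ^+ k.
  rewrite mulr_sumr; apply: eq_bigr => k _; rewrite /bump add1n.
  rewrite derivZ deriv_exp derivB derivC subr0 /= -scaler_nat scalerA.
  rewrite -mulrA mulVf ?natr_neq0 // mulr1 2!exprS !mulN1r opprK -mul_polyC.
  by rewrite -[1 - p]opprB [in RHS]exprNn rmorphXn rmorphN1 mulrCA.
have q0 : (1 - p)`_0 = 0 by rewrite coefB coef1 p0 subrr.
rewrite mulrCA -[X in X * \sum_(_ < _) _](subKr 1) -[1 - (1 - p)]opprB.
rewrite mulNr -subrX1 opprB mulrBr mulr1 addrAC subrr add0r dvdpNr.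
by rewrite dvdp_mull // dvdXn_exp.
Qed.

(** Differentiation shifts the terms of the sum, so the two sides differ only by p' p^N / N!. *)
Lemma exp_congr {R : fieldType} (charR0 : [pchar R] =i pred0) (N : nat)
    (p : {poly R}) : p`_0 = 0 ->
  'X^N %| (\sum_(k < N.+1) (k`!)%:R^-1 *: p ^+ k)^`()
          - p^`() * \sum_(k < N.+1) (k`!)%:R^-1 *: p ^+ k.
Proof.
move=> p0; rewrite [X in _ - _ * X]big_ord_recr /=.
rewrite raddf_sum big_ord_recl /= expr0 derivZ derivC scaler0 add0r.
have -> : \sum_(k < N) ((bump 0 k)`!%:R^-1 *: p ^+ bump 0 k)^`()
          = p^`() * \sum_(k < N) k`!%:R^-1 *: p ^+ k.
  rewrite mulr_sumr; apply: eq_bigr => k _; rewrite /bump add1n.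
  rewrite derivZ deriv_exp -scaler_nat scalerA /= -scalerAr; congr (_ *: _).
  by rewrite factS natrM invfM mulrAC mulVf ?mul1r // natr_neq0.
rewrite mulrDr opprD addrA subrr add0r dvdpNr -scalerAr.
by rewrite -mul_polyC dvdp_mull // dvdp_mull // dvdXn_exp.
Qed.

(** * Exponential generating functions and their differential equations *)

Definition egf {R : fieldType} (N : nat) (p : nat -> R) : {poly R} :=
  \poly_(i < N.+1) (p i / (i`!)%:R).

Lemma coef_egfM {R : fieldType} (charR0 : [pchar R] =i pred0) (N : nat)
    (p q : nat -> R) (n : nat) : (n < N.+1)%N ->
  (egf N p * egf N q)`_n
  = (\sum_(k < n.+1) 'C(n, k)%:R * p k * q (n - k)%N) / (n`!)%:R.
Proof.
move=> ltnN; rewrite coefM mulr_suml; apply: eq_bigr => k _.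
have lekn : (k <= n)%N by rewrite -ltnS.
rewrite !coef_poly (leq_ltn_trans lekn ltnN) (leq_ltn_trans (leq_subr k n) ltnN).
rewrite -(bin_fact lekn) !natrM.
have := fact_neq0 charR0 k; have := fact_neq0 charR0 (n - k).
have : ('C(n, k)%:R : R) != 0.
  by rewrite ((pcharf0P R).1 charR0) -lt0n bin_gt0.
move=> *; field; by apply/and3P.
Qed.

Lemma coef_egf_deriv {R : fieldType} (charR0 : [pchar R] =i pred0) (N : nat)
    (p : nat -> R) (n : nat) : (n < N)%N ->
  ((egf N p)^`())`_n = p n.+1 / (n`!)%:R.
Proof.
move=> ltnN; rewrite coef_deriv coef_poly ltnS ltnN -[LHS]mulr_natr factS natrM invfM.
by rewrite [(_.+1%:R)^-1 * _]mulrC mulrA divfK // natr_neq0.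
Qed.

Lemma egf_flow_iter {R : fieldType} (charR0 : [pchar R] =i pred0) (N : nat) (c v : R) :
  let a := egf N (fun n => (flow_iter c n).[v]) in
  'X^N %| a^`() - (a * a - c%:P).
Proof.
apply/dvdXnP => n ltnN; rewrite !coefB coef_egf_deriv // coef_egfM ?(leqW ltnN) // coefC.
rewrite flow_iter_rec hornerD hornerN hornerC horner_sum mulrBl.
under eq_bigr => k _ do rewrite !hornerM hornerMn hornerC.
case: n ltnN => [|n] _; first by rewrite /= fact0 !divr1 subrr.
by rewrite /= mul0r subrr.
Qed.

Lemma egf_peak_poly {R : fieldType} (charR0 : [pchar R] =i pred0) (N : nat)
    (c v beta : R) :
  let a := egf N (fun n => (flow_iter c n).[v]) in
  let f := egf N (fun n => (peak_poly c beta n).[v]) in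
  'X^N %| f^`() - beta%:P * (a * f).
Proof.
apply/dvdXnP => n ltnN; rewrite !coefB coef_egf_deriv // coefCM coef_egfM ?(leqW ltnN) //.
rewrite peak_poly_rec hornerM hornerC horner_sum mulrA.
under eq_bigr => k _ do rewrite !hornerM hornerMn hornerC.
by rewrite subrr.
Qed.

Lemma peak_poly_horner {R : fieldType} (u v beta s : R) (n : nat) :
  s ^+ 2 = v ^+ 2 - u ^+ 2 ->
  (peak_poly (s ^+ 2) beta n).[v]
  = \sum_(sigma : 'S_n)
      u ^+ (2 * peakL sigma) * v ^+ (n - 2 * peakL sigma) * beta ^+ RLmin sigma.
Proof.
move=> hs; rewrite horner_sum; apply: eq_bigr => sigma _.
rewrite !hornerM !horner_exp hornerD hornerN !hornerC hornerXn hornerX.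
by rewrite hs subKr exprM.
Qed.

(** * Derivatives of the hyperbolic series *)

Lemma sinh_deriv {R : fieldType} (charR0 : [pchar R] =i pred0) (N : nat) (s : R) :
  'X^N %| (\poly_(i < N.+1) ps_sinh s i)^`() - s%:P * \poly_(i < N.+1) ps_cosh s i.
Proof.
apply/dvdXnP => n ltnN; rewrite coefB coef_deriv coefCM !coef_poly !ltnS ltnN ltnW //.
rewrite /ps_sinh /ps_cosh /= if_neg; case: ifP => _; first by rewrite mulr0 mul0rn subrr.
rewrite -[X in X - _]mulr_natr factS natrM invfM exprS.
by rewrite [(_.+1%:R)^-1 * _]mulrC mulrA divfK ?natr_neq0 // mulrA subrr.
Qed.

Lemma cosh_deriv {R : fieldType} (charR0 : [pchar R] =i pred0) (N : nat) (s : R) :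
  'X^N %| (\poly_(i < N.+1) ps_cosh s i)^`() - s%:P * \poly_(i < N.+1) ps_sinh s i.
Proof.
apply/dvdXnP => n ltnN; rewrite coefB coef_deriv coefCM !coef_poly !ltnS ltnN ltnW //.
rewrite /ps_sinh /ps_cosh /= if_neg; case: ifP => _; last by rewrite mulr0 mul0rn subrr.
rewrite -[X in X - _]mulr_natr factS natrM invfM exprS.
by rewrite [(_.+1%:R)^-1 * _]mulrC mulrA divfK ?natr_neq0 // mulrA subrr.
Qed.

(** * Comparison with the power of the base *)

Theorem theorem4p2 (R : fieldType) (charR0 : [pchar R] =i pred0)
  (u v beta s : R) (hs : s ^+ 2 = v ^+ 2 - u ^+ 2) (hs0 : s != 0) (n : nat) :
  (\sum_(sigma : 'S_n)
      u ^+ (2 * peakL sigma) * v ^+ (n - 2 * peakL sigma) * beta ^+ RLmin sigma)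
    / (n`!)%:R
  = ps_powc (base_series s v) beta n.
Proof.
pose C := \poly_(i < n.+1) ps_cosh s i; pose S := \poly_(i < n.+1) ps_sinh s i.
have C0 : C`_0 = 1 by rewrite coef_poly /ps_cosh /= expr0 fact0 divr1.
have S0 : S`_0 = 0 by rewrite coef_poly /ps_sinh.
pose Y := s *: C + (- v) *: S.
have Y0 : Y`_0 = s by rewrite coefD !coefZ C0 S0 mulr1 mulr0 addr0.
have Y0n : Y`_0 != 0 by rewrite Y0.
have truncY : truncates n.+1 Y
    (ps_add (ps_scale s (ps_cosh s)) (ps_scale (- v) (ps_sinh s))).
  by apply: truncates_add; apply: truncates_scale; apply: truncates_poly.
pose I := (Y`_0)^-1 *: \sum_(k < n.+1) (1 - (Y`_0)^-1 *: Y) ^+ k.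
pose B := s *: I.
have truncB : truncates n.+1 B (base_series s v).
  by apply: truncates_scale; apply: truncates_inv.
have YB : 'X^(n.+1) %| Y * B - s%:P.
  have -> : Y * B - s%:P = s%:P * (Y * I - 1) by rewrite /B -mul_polyC; ring.
  by rewrite dvdp_mull // inv_congr.
have B0 : B`_0 = 1.
  have /dvdXnP /(_ 0%N isT) := YB.
  rewrite coefB coefC coef0M Y0 => /eqP; rewrite subr_eq0 -{2}[s]mulr1.
  by move=> /eqP /(mulfI hs0).
(* Differentiating Y B = s costs one order of precision. *)
have dYB : 'X^n %| Y^`() * B + Y * B^`().
  by rewrite -derivM -[_^`()]subr0 -(derivC s) -derivB dvdXn_deriv.
pose L := \sum_(k < n.+1) ((-1) ^+ k.+1 / k%:R) *: (B - 1) ^+ k.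
have truncL : truncates n.+1 L (ps_log (base_series s v)) by apply: truncates_log.
have dL : 'X^n %| B * L^`() - B^`() by apply: log_congr.
have L0 : (beta *: L)`_0 = 0 by rewrite coefZ truncL // /ps_log big_geq ?mulr0.
pose E := \sum_(k < n.+1) (k`!)%:R^-1 *: (beta *: L) ^+ k.
have truncE : truncates n.+1 E (ps_powc (base_series s v) beta).
  by apply: truncates_exp => //; apply: truncates_scale.
have dE := exp_congr charR0 n (beta *: L) L0; rewrite -/E in dE.
have E0 : E`_0 = 1.
  by rewrite truncE // /ps_powc /ps_exp big_ord1 /= /ps_one fact0 divr1.
have dC := cosh_deriv charR0 n s; have dS := sinh_deriv charR0 n s.
rewrite -/C -/S in dC dS.
pose a := egf n (fun k => (flow_iter (s ^+ 2) k).[v]).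
have a0 : a`_0 = v by rewrite coef_poly /= hornerX fact0 divr1.
have da : 'X^n %| a^`() - (a * a - (s ^+ 2)%:P) by apply: egf_flow_iter.
pose f := egf n (fun k => (peak_poly (s ^+ 2) beta k).[v]).
have f0 : f`_0 = 1 by rewrite coef_poly /= peak_poly0 hornerC fact0 divr1.
have df : 'X^n %| f^`() - beta%:P * (a * f) by apply: egf_peak_poly.
pose W := (s ^+ 2)%:P * S - (v * s)%:P * C.
have dY : 'X^n %| Y^`() - W.
  have -> : Y^`() - W
      = s%:P * (C^`() - s%:P * S) - v%:P * (S^`() - s%:P * C).
    rewrite /Y /W derivD !derivZ -!mul_polyC !(polyCN, polyCM, rmorphXn) /=; ring.
  by rewrite dvdp_sub // dvdp_mull.
have Yz : 'X^n %| Y * a + W.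
  apply: dvdp_trans (dvdp_exp2l 'X (leqnSn n)) _.
  apply: (linear_ode0 charR0 n a).
    rewrite coefD coef0M Y0 a0 coefB !coefCM S0 C0; ring.
  (* The brackets are the errors in Y' = W, a' = a^2 - s^2 and, through the derivatives of [S] and
     [C], W' = s^2 Y. *)
  have -> : (Y * a + W)^`() - a * (Y * a + W)
      = (Y^`() - W) * a + Y * (a^`() - (a * a - (s ^+ 2)%:P))
        + (s ^+ 2)%:P * (S^`() - s%:P * C) - (v * s)%:P * (C^`() - s%:P * S).
    rewrite derivD derivM /W derivB !deriv_mulC /Y -!mul_polyC.
    rewrite !(polyCN, polyCM, rmorphXn) /=; ring.
  apply: dvdp_sub; last exact: dvdp_mull.
  apply: dvdp_add; last exact: dvdp_mull.
  by apply: dvdp_add; [apply: dvdp_mulr | apply: dvdp_mull].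
have YB' : 'X^n %| Y * B - s%:P := dvdp_trans (dvdp_exp2l 'X (leqnSn n)) YB.
(* Replacing s by Y B, s L' becomes Y B' and s a becomes - Y' B, so s (L' - a) reduces to (Y B)',
   which vanishes. *)
have La : 'X^n %| L^`() - a.
  rewrite -(dvdpZr _ _ hs0) -mul_polyC.
  have -> : s%:P * (L^`() - a)
      = Y * (B * L^`() - B^`()) + (a - L^`()) * (Y * B - s%:P)
        + (Y^`() * B + Y * B^`()) - (Y^`() - W + (Y * a + W)) * B by ring.
  apply: dvdp_sub; last by apply: dvdp_mulr; apply: dvdp_add.
  apply: dvdp_add dYB; exact: dvdp_add (dvdp_mull _ dL) (dvdp_mull _ YB').
(* [E] and [f] both start with 1 and satisfy f' = beta a f modulo ['X^n]; the order gained by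
   [linear_ode0] is what reaches coefficient n. *)
have /dvdXnP /(_ n (ltnSn n)) : 'X^(n.+1) %| E - f.
  apply: (linear_ode0 charR0 n (beta%:P * a)); first by rewrite coefB E0 f0 subrr.
  have -> : (E - f)^`() - beta%:P * a * (E - f)
      = (E^`() - (beta *: L)^`() * E) + beta%:P * E * (L^`() - a)
        - (f^`() - beta%:P * (a * f)).
    by rewrite derivB derivZ -mul_polyC; ring.
  by apply: dvdp_sub => //; apply: dvdp_add => //; apply: dvdp_mull.
rewrite coefB truncE // coef_poly ltnSn -(peak_poly_horner u v beta s n hs).
by move=> /eqP; rewrite subr_eq0 => /eqP.
Qed.
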